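(* Let $\mathscr{U}$ be any category and let $\mathscr{C}$ be a Hausdorff linearly topologized pseudo-abelian (additive) category such that $\mathrm{End}_{\mathscr{C}}(C)$ has Fitting's Property for all $C\in\mathscr{C}$. Let $F:\mathscr{U}\to\mathscr{C}$ be a functor and let $t:F\to F$ be a natural transformation. Then there are functors $F_0,F_1:\mathscr{U}\to\mathscr{C}$ and natural transformations $t_0:F_0\to F_0$, $t_1:F_1\to F_1$ such that: (1) $F=F_0\oplus F_1$ (i.e. $FU=F_0U\oplus F_1U$ for all $U\in\mathscr{U}$); (2) $t=t_0\oplus t_1$ (i.e. $t_U=(t_0)_U\oplus(t_1)_U$ for all $U\in\mathscr{U}$); (3) $t_1$ is a natural isomorphism; (4) $((t_0)_U)^n\to0$ as $n\to\infty$ in $\mathrm{End}_{\mathscr{C}}(F_0U)$ for all $U\in\mathscr{U}$. The decomposition $F=F_0\oplus F_1$ is unique up to natural isomorphism.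
   Context: The category $\mathscr{U}$ is not assumed small. Direct sums of functors and natural transformations are formed objectwise, and $F=F_0\oplus F_1$ is a direct sum decomposition of functors, with $FU$ identified with the biproduct $F_0U\oplus F_1U$. If needed, one assumes a form of the axiom of choice for classes (a choice function for every class of nonempty classes), allowing one to choose summands corresponding to idempotents of objects of $\mathscr{C}$ simultaneously. An additive category $\mathscr{C}$ is pseudo-abelian if for every $C\in\mathscr{C}$ and every idempotent $e\in\mathrm{End}_{\mathscr{C}}(C)$ there are an object $S$ and morphisms $i:S\to C$, $p:C\to S$ with $i\circ p=e$ and $p\circ i=\mathrm{id}_S$. A topological ring is linearly topologized (LT) if it has a basis of neighborhoods of $0$ consisting of two-sided ideals. An ideal $I$ of an additive category $\mathscr{C}$ assigns to every $X,Y\in\mathscr{C}$ an additive subgroup $I(X,Y)\subseteq\mathrm{Hom}_{\mathscr{C}}(X,Y)$ with $\mathrm{Hom}_{\mathscr{C}}(Y,Y')\circ I(X,Y)\circ\mathrm{Hom}_{\mathscr{C}}(X',X)\subseteq I(X',Y')$ for all $X',Y'$. A linearly topologized category is a pair $(\mathscr{C},\mathcal{I})$ with $\mathscr{C}$ additive and $\mathcal{I}$ a nonempty collection of ideals of $\mathscr{C}$ such that for all $I,J\in\mathcal{I}$ there is $K\in\mathcal{I}$ with $K(X,Y)\subseteq I(X,Y)\cap J(X,Y)$ for all $X,Y$. The cosets $f+I(X,Y)$ ($I\in\mathcal{I}$) generate a topology on $\mathrm{Hom}_{\mathscr{C}}(X,Y)$, and $\mathrm{End}_{\mathscr{C}}(X)$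 is an LT ring with basis $\{I(X,X)\}_{I\in\mathcal{I}}$ of neighborhoods of $0$. The LT category is Hausdorff if $\bigcap_{I\in\mathcal{I}}I(X,Y)=0$ for all $X,Y$. A Hausdorff LT ring $R$ has Fitting's Property if for every $n\ge1$ and $a\in\mathrm{M}_n(R)$ (with the product topology of $R^{n^2}$) there is an idempotent $e\in\mathrm{M}_n(R)$ such that $a=eae+(1-e)a(1-e)$, $eae$ is invertible in $e\mathrm{M}_n(R)e$, and $(1-e)a^k(1-e)\to0$ as $k\to\infty$. *)

(* Defs.v *)
From HB Require Import structures.
From mathcomp Require Import all_boot all_algebra.
From mathcomp Require Import all_classical topology tvs.

Set Implicit Arguments.
Unset Strict Implicit.
Unset Printing Implicit Defensive.

Import GRing.Theory.
Local Open Scope classical_set_scope.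
Local Open Scope ring_scope.

Record category := Category {
  obj :> Type;
  mor : obj -> obj -> Type;
  idmor : forall X, mor X X;
  compose : forall X Y Z, mor Y Z -> mor X Y -> mor X Z;
  compose_idl : forall X Y (f : mor X Y), compose (idmor Y) f = f;
  compose_idr : forall X Y (f : mor X Y), compose f (idmor X) = f;
  composeA : forall X Y Z W (h : mor Z W) (g : mor Y Z) (f : mor X Y),
    compose h (compose g f) = compose (compose h g) f }.

Arguments idmor {c} X.
Notation "g \oc f" := (compose g f) (at level 40, left associativity).

Record functor (U C : category) := Functor {
  fobj :> U -> C;
  fmor : forall X Y : U, mor X Y -> mor (fobj X) (fobj Y);
  fmor_id : forall X, fmor (idmor X) = idmor (fobj X);
  fmor_comp : forall X Y Z (g : mor Y Z) (f : mor X Y),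
    fmor (g \oc f) = fmor g \oc fmor f }.

Record nattrans (U C : category) (F G : functor U C) := NatTrans {
  component :> forall X : U, mor (F X) (G X);
  naturality : forall X Y (u : mor X Y),
    fmor G u \oc component X = component Y \oc fmor F u }.

Definition is_iso (C : category) (X Y : C) (f : mor X Y) :=
  exists g : mor Y X, g \oc f = idmor X /\ f \oc g = idmor Y.

Definition nat_iso (U C : category) (F G : functor U C) (t : nattrans F G) :=
  forall X, is_iso (t X).

(* Under the axioms of boolp every type carries an eqType and a choiceType
   structure, so asking for a zmodType is asking for an abelian group law. *)
Record preadditive := Preadditive {
  preadditive_category :> category;
  mor_zmod : forall X Y : preadditive_category, GRing.Zmodule (mor X Y);
  morZ : forall X Y : preadditive_category, zmodType :=
    fun X Y => GRing.Zmodule.Pack (mor_zmod X Y);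
  composeDl : forall X Y Z (g g' : morZ Y Z) (f : morZ X Y),
    (g + g' : morZ Y Z) \oc f = (g \oc f : morZ X Z) + g' \oc f;
  composeDr : forall X Y Z (g : morZ Y Z) (f f' : morZ X Y),
    g \oc (f + f' : morZ X Y) = (g \oc f : morZ X Z) + g \oc f' }.

HB.instance Definition _ (C : preadditive) (X Y : C) :=
  GRing.Zmodule.copy (mor X Y) (morZ X Y).

Definition zero_object (C : preadditive) (Z : C) :=
  forall X, (forall f : mor X Z, f = 0) /\ (forall f : mor Z X, f = 0).

Definition is_biproduct (C : preadditive) (X0 X1 S : C)
    (i0 : mor X0 S) (i1 : mor X1 S) (p0 : mor S X0) (p1 : mor S X1) :=
  [/\ p0 \oc i0 = idmor X0, p1 \oc i1 = idmor X1, p0 \oc i1 = 0, p1 \oc i0 = 0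
    & i0 \oc p0 + i1 \oc p1 = idmor S].

Record additive_category := AdditiveCategory {
  additive_preadditive :> preadditive;
  has_zero_object : exists Z : additive_preadditive, zero_object Z;
  has_biproducts : forall X0 X1 : additive_preadditive,
    exists (S : additive_preadditive) (i0 : mor X0 S) (i1 : mor X1 S)
      (p0 : mor S X0) (p1 : mor S X1), is_biproduct i0 i1 p0 p1 }.

Definition pseudo_abelian (C : additive_category) :=
  forall (X : C) (e : mor X X), e \oc e = e ->
  exists (S : C) (i : mor S X) (p : mor X S),
    i \oc p = e /\ p \oc i = idmor S.

Definition endo (C : preadditive) (X : C) := mor X X.

HB.instance Definition _ (C : preadditive) (X : C) :=
  GRing.Zmodule.on (endo X).

HB.instance Definition _ (C : preadditive) (X : C) :=
  GRing.Zmodule_isPzRing.Build (endo X)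
    (@composeA C X X X X) (@compose_idl C X X) (@compose_idr C X X)
    (fun f g h => @composeDl C X X X f g h)
    (fun f g h => @composeDr C X X X f g h).

(* Linearly topologized rings; the trivial ring (the endomorphism ring of a
   zero object) has to be allowed, hence pzRingType. *)

HB.mixin Record TopologicalZmodule_isTopologicalRing R
    & TopologicalZmodule R & GRing.PzRing R := {
  ring_mul_continuous : continuous (fun z : R * R => z.1 * z.2) }.

#[short(type="topologicalRingType")]
HB.structure Definition TopologicalRing :=
  {R of TopologicalZmodule R & GRing.PzRing R
      & TopologicalZmodule_isTopologicalRing R}.

Definition two_sided_ideal (R : pzRingType) (J : set R) :=
  [/\ J 0, forall x y, J x -> J y -> J (x - y)
    & forall a x b, J x -> J (a * x * b)].

HB.mixin Record TopologicalRing_isLT R & TopologicalRing R := {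
  lt_basis : forall A : set R, nbhs 0 A ->
    exists J : set R, [/\ two_sided_ideal J, nbhs 0 J & J `<=` A] }.

#[short(type="ltRingType")]
HB.structure Definition LTRing :=
  {R of TopologicalRing R & TopologicalRing_isLT R}.

(* x is invertible in the ring e * R * e, whose unit is e *)
Definition corner_unit (R : pzRingType) (e x : R) :=
  exists y, [/\ y = e * y * e, x * y = e & y * x = e].

(* Matrices carry the product topology. Rings with this property are required
   to be Hausdorff; for endomorphism rings in a Hausdorff linearly topologized
   category this is mor_hausdorff below. *)
Definition fitting_property (R : ltRingType) :=
  forall (n : nat) (a : 'M[R]_n), (1 <= n)%N ->
  exists e : 'M[R]_n,
    [/\ e * e = e,
        a = e * a * e + (1 - e) * a * (1 - e),
        corner_unit e (e * a * e)
      & (fun k => (1 - e) * a ^+ k * (1 - e)) @ \oo --> (0 : 'M[R]_n)].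

Record ideal (C : preadditive) := Ideal {
  ideal_set :> forall X Y : C, set (mor X Y);
  ideal0 : forall X Y, ideal_set (0 : mor X Y);
  idealB : forall X Y (f g : mor X Y),
    ideal_set f -> ideal_set g -> ideal_set (f - g);
  ideal_comp : forall X' X Y Y' (h : mor Y Y') (f : mor X Y) (g : mor X' X),
    ideal_set f -> ideal_set (h \oc f \oc g) }.

Arguments ideal_set {C} i X Y _.

Record lt_category := LTCategory {
  lt_additive :> additive_category;
  lt_ideals : set (ideal lt_additive);
  lt_ideals_nonempty : lt_ideals !=set0;
  lt_ideals_directed : forall I J, lt_ideals I -> lt_ideals J ->
    exists2 K, lt_ideals K & forall X Y, K X Y `<=` I X Y `&` J X Y }.

Arguments lt_ideals : clear implicits.

Definition hausdorff_category (C : lt_category) :=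
  forall X Y : C, \bigcap_(I in lt_ideals C) I X Y = [set 0].

Section MorTopology.
Variables (C : lt_category) (X Y : C).
Implicit Types (f g : mor X Y) (I : ideal C).

Definition ideal_coset f I : set (mor X Y) := [set g | I X Y (g - f)].

Definition mor_nbhs f : set_system (mor X Y) :=
  filter_from (lt_ideals C) (ideal_coset f).

Lemma idealN I f : I X Y f -> I X Y (- f).
Proof. by move=> If; rewrite -sub0r; apply: idealB => //; exact: ideal0. Qed.

Lemma idealD I f g : I X Y f -> I X Y g -> I X Y (f + g).
Proof. by move=> If Ig; rewrite -[g]opprK; apply/idealB/idealN. Qed.

Lemma ideal_coset_refl f I : ideal_coset f I f.
Proof. by rewrite /ideal_coset /= subrr; exact: ideal0. Qed.

Lemma ideal_coset_trans g f I :
  ideal_coset f I g -> ideal_coset g I `<=` ideal_coset f I.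
Proof.
by move=> fg h gh; rewrite /ideal_coset /= -(subrKA g); exact: idealD.
Qed.

Lemma mor_nbhs_filter f : ProperFilter (mor_nbhs f).
Proof.
apply: filter_from_proper => [|I _]; last by exists f; exact: ideal_coset_refl.
apply: filter_from_filter => [|I J DI DJ]; first exact: lt_ideals_nonempty.
have [K DK sK] := lt_ideals_directed DI DJ.
by exists K => // g /sK.
Qed.

Lemma mor_nbhs_singleton f (A : set (mor X Y)) : mor_nbhs f A -> A f.
Proof. by move=> [I _]; apply; exact: ideal_coset_refl. Qed.

Lemma mor_nbhs_nbhs f (A : set (mor X Y)) :
  mor_nbhs f A -> mor_nbhs f (mor_nbhs^~ A).
Proof.
move=> [I DI sA]; exists I => // g fg; exists I => //.
exact: subset_trans (ideal_coset_trans fg) sA.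
Qed.

HB.instance Definition _ := hasNbhs.Build (mor X Y) mor_nbhs.

HB.instance Definition _ := Nbhs_isNbhsTopological.Build (mor X Y)
  mor_nbhs_filter mor_nbhs_singleton mor_nbhs_nbhs.

Lemma ideal_coset_basis :
  basis [set A | exists f I, lt_ideals C I /\ A = ideal_coset f I].
Proof.
split=> [_ [f [I [DI ->]]]|f A [I DI sA]].
  by rewrite openE => g fg; exists I => //; exact: ideal_coset_trans.
exists (ideal_coset f I) => //; split; last exact: ideal_coset_refl.
by exists f, I.
Qed.

Lemma mor_sub_continuous :
  continuous (fun z : mor X Y * mor X Y => z.1 - z.2).
Proof.
move=> [f g] A [I DI sA].
exists (ideal_coset f I, ideal_coset g I); first by split; exists I.
move=> [f' g'] [/= If Ig]; apply: sA; rewrite /ideal_coset /=.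
rewrite opprB [g - f]addrC addrACA [- g' + g]addrC -(opprB g' g).
exact: idealB.
Qed.

HB.instance Definition _ :=
  PreTopologicalNmodule_isTopologicalZmodule.Build (mor X Y)
    mor_sub_continuous.

Lemma mor_hausdorff : hausdorff_category C -> hausdorff_space (mor X Y).
Proof.
move=> hC f g fg; apply/eqP; rewrite -subr_eq0; apply/eqP.
have : (\bigcap_(I in lt_ideals C) I X Y) (f - g).
  move=> I DI.
  have [||h [hf hg]] := fg (ideal_coset f I) (ideal_coset g I);
    try by exists I.
  rewrite -(subrKA h) -[f - h]opprB.
  by apply: idealD => //; exact: idealN.
by rewrite hC.
Qed.

End MorTopology.

Section EndTopology.
Variables (C : lt_category) (X : C).

HB.instance Definition _ := TopologicalZmodule.on (endo X).

Lemma endo_idealMl (I : ideal C) (f g : endo X) : I X X g -> I X X (f * g).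
Proof.
by move=> Ig; rewrite -[f * g]mulr1; exact: (ideal_comp f (idmor X) Ig).
Qed.

Lemma endo_idealMr (I : ideal C) (f g : endo X) : I X X f -> I X X (f * g).
Proof.
by move=> If; rewrite -[f]mul1r; exact: (ideal_comp (idmor X) g If).
Qed.

Lemma endo_mul_continuous :
  continuous (fun z : endo X * endo X => z.1 * z.2).
Proof.
move=> [f g] A [I DI sA].
exists (ideal_coset f I, ideal_coset g I); first by split; exists I.
move=> [f' g'] [/= If Ig]; apply: sA; rewrite /ideal_coset /=.
have -> : f' * g' - f * g = (f' - f) * g' + f * (g' - g) :> endo X.
  by rewrite mulrBl mulrBr addrA subrK.
by apply: idealD; [exact: endo_idealMr|exact: endo_idealMl].
Qed.

HB.instance Definition _ :=
  TopologicalZmodule_isTopologicalRing.Build (endo X) endo_mul_continuous.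

Lemma endo_lt_basis (A : set (endo X)) : nbhs 0 A ->
  exists J : set (endo X), [/\ two_sided_ideal J, nbhs 0 J & J `<=` A].
Proof.
move=> [I DI sA]; exists (I X X : set (endo X)); split.
- split=> [|f g|f g h Ig]; [exact: ideal0|exact: idealB|].
  exact: ideal_comp.
- by exists I => // f; rewrite /ideal_coset /= subr0.
- by move=> f If; apply: sA; rewrite /ideal_coset /= subr0.
Qed.

HB.instance Definition _ := TopologicalRing_isLT.Build (endo X) endo_lt_basis.

End EndTopology.

(* F = F0 (+) F1: every F U is a biproduct of F0 U and F1 U, and naturality of
   the structure maps says that F u = F0 u (+) F1 u for every morphism u. *)
Record decomposition (U : category) (C : preadditive) (F F0 F1 : functor U C) :=
  Decomposition {
    inj0 : nattrans F0 F;
    inj1 : nattrans F1 F;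
    prj0 : nattrans F F0;
    prj1 : nattrans F F1;
    decomposition_biproduct : forall X,
      is_biproduct (inj0 X) (inj1 X) (prj0 X) (prj1 X) }.

Section Decompositions.
Variables (U : category) (C : lt_category) (F : functor U C).

Definition fitting_decomposition (t : nattrans F F) (F0 F1 : functor U C)
    (D : decomposition F F0 F1) (t0 : nattrans F0 F0) (t1 : nattrans F1 F1) :=
  [/\ forall X, t X = inj0 D X \oc t0 X \oc prj0 D X
                      + inj1 D X \oc t1 X \oc prj1 D X,
      nat_iso t1
    & forall X, (fun n => (t0 X : endo (F0 X)) ^+ n) @ \oo
                  --> (0 : endo (F0 X))].

(* Isomorphism of decompositions of the same F: natural isomorphisms of the
   summands compatible with the identification of F with the direct sums. *)
Definition isomorphic_decompositions (F0 F1 F0' F1' : functor U C)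
    (D : decomposition F F0 F1) (D' : decomposition F F0' F1') :=
  exists (s0 : nattrans F0 F0') (s1 : nattrans F1 F1'),
    [/\ nat_iso s0, nat_iso s1
      & forall X, [/\ inj0 D' X \oc s0 X = inj0 D X,
                      inj1 D' X \oc s1 X = inj1 D X,
                      s0 X \oc prj0 D X = prj0 D' X
                    & s1 X \oc prj1 D X = prj1 D' X]].

End Decompositions.

(* Main.v *)
(** Let [y] invert [t] on the Fitting summand cut out by the idempotent [e] of
    an endomorphism [t], so that [e = t y = y t].  If [f t = t' f], then
    [(1 - e') f e = ((1 - e') t'^k) f e y^k] and
    [e' f (1 - e) = y'^k e' f ((1 - e) t^k)] for every [k]; both tend to [0],
    so both vanish and [f e = e' f].  Hence the idempotents of the components
    of a natural transformation are themselves natural, and splitting them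
    gives the decomposition.  Taking [f = 1] shows that [e] depends only on
    [t], which is uniqueness. *)
From HB Require Import structures.
From mathcomp Require Import all_boot all_algebra.
From mathcomp Require Import all_classical topology tvs.
Require Import Defs.

Set Implicit Arguments.
Unset Strict Implicit.
Unset Printing Implicit Defensive.

Import GRing.Theory.
Local Open Scope classical_set_scope.
Local Open Scope ring_scope.

(** * Bilinearity of composition and intertwined powers *)

Section Preadditive.
Variable C : preadditive.
Implicit Types X Y Z : C.

Lemma compDl X Y Z (g g' : mor Y Z) (f : mor X Y) :
  (g + g') \oc f = g \oc f + g' \oc f.
Proof. exact: composeDl. Qed.

Lemma compDr X Y Z (g : mor Y Z) (f f' : mor X Y) :
  g \oc (f + f') = g \oc f + g \oc f'.
Proof. exact: composeDr. Qed.

Lemma comp0l X Y Z (f : mor X Y) : (0 : mor Y Z) \oc f = 0.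
Proof. by apply: (addIr ((0 : mor Y Z) \oc f)); rewrite -compDl !add0r. Qed.

Lemma comp0r X Y Z (g : mor Y Z) : g \oc (0 : mor X Y) = 0.
Proof. by apply: (addIr (g \oc (0 : mor X Y))); rewrite -compDr !add0r. Qed.

Lemma compBl X Y Z (g g' : mor Y Z) (f : mor X Y) :
  (g - g') \oc f = g \oc f - g' \oc f.
Proof. by apply: (addIr (g' \oc f)); rewrite -compDl !subrK. Qed.

Lemma compBr X Y Z (g : mor Y Z) (f f' : mor X Y) :
  g \oc (f - f') = g \oc f - g \oc f'.
Proof. by apply: (addIr (g \oc f')); rewrite -compDr !subrK. Qed.

Lemma comp_intertwine_exp X Y (f : mor X Y) (a : endo X) (b : endo Y) k :
  f \oc a = b \oc f -> f \oc (a ^+ k : endo X) = (b ^+ k : endo Y) \oc f.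
Proof.
move=> fa; elim: k => [|k IHk]; first by rewrite compose_idl compose_idr.
rewrite !exprS -[a * _]/(a \oc _) -[b * _]/(b \oc _). 
rewrite composeA fa -composeA IHk; exact: composeA.
Qed.

End Preadditive.

(** * Splitting idempotent natural transformations *)

Section NaturalTransformations.
Variable U : category.

Program Definition nat_comp (C : category) (F G H : functor U C)
    (s : nattrans G H) (t : nattrans F G) : nattrans F H :=
  {| component := fun X => s X \oc t X |}.
Next Obligation.
move=> C F G H s t X Y u /=; rewrite composeA naturality -composeA naturality.
exact: composeA.
Qed.

Program Definition nat_complement (C : preadditive) (F : functor U C)
    (E : nattrans F F) : nattrans F F :=
  {| component := fun X => idmor (F X) - E X |}.
Next Obligation.
move=> C F E X Y u /=.
by rewrite compBr compBl compose_idl compose_idr naturality.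
Qed.

(** Each [E X] is split separately, and [G u] is the compression [p F(u) i]. Naturality of [E] makes
    this functorial and makes [i] and [p] natural. *)
Lemma split_idempotent_nattrans (C : additive_category) (F : functor U C)
    (E : nattrans F F) :
  pseudo_abelian C -> (forall X, E X \oc E X = E X) ->
  exists (G : functor U C) (i : nattrans G F) (p : nattrans F G),
    forall X, i X \oc p X = E X /\ p X \oc i X = idmor (G X).
Proof.
move=> Cpa EE.
(* Choice turns the mere existence of splittings into one splitting for every [X] at once. *)
have split X : {S : C & {i : mor S (F X) & {p : mor (F X) S |
    i \oc p = E X /\ p \oc i = idmor S}}}.
  have [S /cid[i /cid[p ?]]] := cid (Cpa _ _ (EE X)).
  by exists S, i, p.
pose S X := projT1 (split X).
pose i X : mor (S X) (F X) := projT1 (projT2 (split X)).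
pose p X : mor (F X) (S X) := sval (projT2 (projT2 (split X))).
have ip X : i X \oc p X = E X := (svalP (projT2 (projT2 (split X)))).1.
have pi X : p X \oc i X = idmor (S X) :=
  (svalP (projT2 (projT2 (split X)))).2.
have Ei X : E X \oc i X = i X by rewrite -ip -composeA pi compose_idr.
have pE X : p X \oc E X = p X by rewrite -ip composeA pi compose_idl.
have G1 X : p X \oc fmor F (idmor X) \oc i X = idmor (S X).
  by rewrite fmor_id compose_idr pi.
have GM X Y Z (g : mor Y Z) (f : mor X Y) :
    p Z \oc fmor F (g \oc f) \oc i X =
    (p Z \oc fmor F g \oc i Y) \oc (p Y \oc fmor F f \oc i X).
  (* The inner [i Y \oc p Y] is [E Y], which moves past [fmor F f] and is absorbed by [i X]. *)
  rewrite fmor_comp -!composeA; congr (_ \oc (_ \oc _)).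
  by rewrite !composeA ip -naturality -composeA Ei.
pose G := Functor G1 GM.
have iN X Y (u : mor X Y) : fmor F u \oc i X = i Y \oc fmor G u.
  by rewrite /= !composeA ip -naturality -composeA Ei.
have pN X Y (u : mor X Y) : fmor G u \oc p X = p Y \oc fmor F u.
  by rewrite /= -!composeA ip naturality composeA pE.
by exists G, (NatTrans (F := G) iN), (NatTrans (G := G) pN).
Qed.

(** Two splittings of the same idempotent differ by a canonical isomorphism: [p' i] and [p i'] are
    mutually inverse. *)
Lemma nat_comp_retract (C : category) (F G G' : functor U C)
    (i : nattrans G F) (p : nattrans F G) (i' : nattrans G' F)
    (p' : nattrans F G') :
  (forall X, p X \oc i X = idmor (G X)) ->
  (forall X, p' X \oc i' X = idmor (G' X)) ->
  (forall X, i X \oc p X = i' X \oc p' X) ->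
  [/\ nat_iso (nat_comp p' i), forall X, i' X \oc nat_comp p' i X = i X
    & forall X, nat_comp p' i X \oc p X = p' X].
Proof.
move=> pi pi' ip; split=> X /=; first exists (p X \oc i' X); first split.
- by rewrite composeA -(composeA (p X)) -ip composeA pi compose_idl pi.
- by rewrite composeA -(composeA (p' X)) ip composeA pi' compose_idl pi'.
- by rewrite composeA -ip -composeA pi compose_idr.
- by rewrite -composeA ip composeA pi' compose_idl.
Qed.

End NaturalTransformations.

(** * Algebra of a Fitting idempotent *)

Section FittingRing.
Variables (R : pzRingType) (a e : R).
Hypothesis ee : e * e = e.

(** The block form of [a] gives [e a = a e = e a e], and the corner inverse [y] absorbs [e] on both
    sides. *)
Lemma corner_unit_inverse :
  a = e * a * e + (1 - e) * a * (1 - e) -> corner_unit e (e * a * e) ->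
  exists y, a * y = e /\ y * a = e.
Proof.
move=> aE [y [yE xy yx]].
have ef : e * (1 - e) = 0 by rewrite mulrBr mulr1 ee subrr.
have fe : (1 - e) * e = 0 by rewrite mulrBl mul1r ee subrr.
have ea : e * a = e * a * e.
  by rewrite {1}aE mulrDr !mulrA ef !mul0r addr0 ee.
have ae : a * e = e * a * e.
  by rewrite {1}aE mulrDl -!mulrA fe !mulr0 addr0 ee.
have ey : e * y = y by rewrite yE !mulrA ee.
have ye : y * e = y by rewrite yE -!mulrA ee.
by exists y; rewrite -{1}ey mulrA ae xy -{1}ye -mulrA ea yx.
Qed.

Variable y : R.
Hypotheses (ay : a * y = e) (ya : y * a = e).

(** Both [e a] and [a e] equal [a y a]. *)
Lemma fitting_commX k : e * a ^+ k = a ^+ k * e.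
Proof. by apply: commrX; rewrite /GRing.comm -{1}ay -ya mulrA. Qed.

Lemma fitting_complementX k : (1 - e) * a ^+ k = a ^+ k * (1 - e).
Proof. by rewrite mulrBl mulrBr mul1r mulr1 fitting_commX. Qed.

Lemma fitting_complement_cornerX k :
  (1 - e) * a ^+ k * (1 - e) = (1 - e) * a ^+ k.
Proof.
rewrite fitting_complementX -mulrA; congr (_ * _).
by rewrite mulrBl mul1r mulrBr mulr1 ee subrr subr0.
Qed.

(** The product collapses from the inside by [a e y = e]; the middle [e] makes the case [k = 0]
    true. *)
Lemma fitting_idempotentXl k : a ^+ k * e * y ^+ k = e.
Proof.
have aey : a * e * y = e by rewrite -{1}ya !mulrA ay -mulrA ay ee.
elim: k => [|k IHk]; first by rewrite !expr0 mulr1 mul1r.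
transitivity (a ^+ k * (a * e * y) * y ^+ k); last by rewrite aey.
by rewrite exprSr exprS !mulrA.
Qed.

Lemma fitting_idempotentXr k : y ^+ k * e * a ^+ k = e.
Proof.
have yea : y * e * a = e by rewrite -{1}ay !mulrA ya -mulrA ya ee.
elim: k => [|k IHk]; first by rewrite !expr0 mulr1 mul1r.
transitivity (y ^+ k * (y * e * a) * a ^+ k); last by rewrite yea.
by rewrite exprSr exprS !mulrA.
Qed.

End FittingRing.

(** * Null sequences and naturality of Fitting idempotents *)

Section LinearTopology.
Variable C : lt_category.
Implicit Types X Y : C.

Lemma cvg0P X Y (u : nat -> mor X Y) :
  u @ \oo --> (0 : mor X Y) <->
  forall I, lt_ideals C I -> \forall k \near \oo, I X Y (u k).
Proof.
split=> [u0 I DI|u0 A [I DI sA]].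
  apply: (u0 (I X Y)); exists I => // f.
  by rewrite /ideal_coset /= subr0.
apply: filterS (u0 I DI) => k Iuk; apply: sA.
by rewrite /ideal_coset /= subr0.
Qed.

(** Ideals absorb composition on both sides, so the outer factors may vary arbitrarily with [k], as
    powers of an inverse do. *)
Lemma cvg0_comp X' X Y Y' (u : nat -> mor X Y) (h : nat -> mor Y Y')
    (g : nat -> mor X' X) :
  u @ \oo --> (0 : mor X Y) ->
  (fun k => h k \oc u k \oc g k) @ \oo --> (0 : mor X' Y').
Proof.
move=> /cvg0P u0; apply/cvg0P => I DI.
by apply: filterS (u0 I DI) => k; exact: ideal_comp.
Qed.

Lemma cvg0_cst_eq0 X Y (f : mor X Y) : hausdorff_category C ->
  (fun _ : nat => f) @ \oo --> (0 : mor X Y) -> f = 0.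
Proof.
move=> hC /cvg0P f0.
suff : (\bigcap_(I in lt_ideals C) I X Y) f by rewrite hC.
by move=> I /f0 [N _ /(_ N (leqnn N))].
Qed.

(** The equations [a y = y a = e] force [e] to commute with [a], so [(1 - e) a^k] is the same as the
    corner term [(1 - e) a^k (1 - e)]. *)
Definition fitting_idempotent X (a e : endo X) :=
  [/\ e * e = e, exists y : endo X, a * y = e /\ y * a = e
    & (fun k => (1 - e) * a ^+ k) @ \oo --> (0 : endo X)].

Lemma fitting_idempotent_natural X Y (f : mor X Y) (a e : endo X)
    (a' e' : endo Y) :
  hausdorff_category C -> fitting_idempotent a e -> fitting_idempotent a' e' ->
  f \oc a = a' \oc f -> f \oc e = e' \oc f.
Proof.
move=> hC [ee [y [ay ya]] a0] [ee' [y' [ay' ya']] a0'] fa.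
have fX k := comp_intertwine_exp k fa.
have eq1 : e' \oc f \oc (1 - e : endo X) = 0.
  apply: cvg0_cst_eq0 => //.
  (* The constant is rewritten for each [k] with the null sequence as middle factor; [idmor X] fills
     the right slot of [cvg0_comp]. *)
  rewrite (_ : (fun _ => _) = fun k => ((y' ^+ k * e' : endo Y) \oc f)
      \oc ((1 - e) * a ^+ k : endo X) \oc idmor X); first exact: cvg0_comp.
  apply/funext => k; rewrite compose_idr (fitting_complementX ay ya).
  rewrite -{1}(fitting_idempotentXr ee' ay' ya' k).
  rewrite -[_ * a' ^+ k]/(_ \oc a' ^+ k) -[a ^+ k * _]/(a ^+ k \oc _).
  rewrite -!composeA; congr (_ \oc _).
  by rewrite !composeA -(composeA e' f) fX composeA.
have eq2 : (1 - e' : endo Y) \oc f \oc e = 0.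
  apply: cvg0_cst_eq0 => //.
  rewrite (_ : (fun _ => _) = fun k => idmor Y \oc
      ((1 - e') * a' ^+ k : endo Y) \oc (f \oc (e * y ^+ k : endo X)));
    first exact: cvg0_comp.
  apply/funext => k; rewrite compose_idl.
  rewrite -{1}(fitting_idempotentXl ee ay ya k) -mulrA.
  rewrite -[a ^+ k * _]/(a ^+ k \oc _) -[_ * a' ^+ k]/(_ \oc a' ^+ k).
  rewrite -!composeA; congr (_ \oc _).
  by rewrite !composeA fX.
(* Expanding the two vanishing blocks shows that [e' f] and [f e] both equal [e' f e]. *)
move: eq1 eq2; rewrite compBr compBl compBl !compose_idl !compose_idr.
by move=> /subr0_eq <- /subr0_eq.
Qed.

(** Fitting's Property is applied with [n = 1]; reading off the single entry is multiplicative and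
    continuous. *)
Lemma fitting_idempotent_ex X (a : endo X) :
  fitting_property (endo X) -> exists e, fitting_idempotent a e.
Proof.
move=> /(_ 1%N a%:M isT) [e [ee aE ae lim]].
have [y [ay ya]] := corner_unit_inverse ee aE ae.
pose entry (M : 'M[endo X]_1) : endo X := M ord0 ord0.
have entryM M N : entry (M * N) = entry M * entry N.
  by rewrite /entry mxE big_ord1.
have entry_a : entry a%:M = a by rewrite /entry mxE eqxx.
have entryX k : entry (a%:M ^+ k) = a ^+ k.
  elim: k => [|k IHk]; first by rewrite /entry mxE eqxx.
  by rewrite !exprS entryM IHk entry_a.
exists (entry e); split; first by rewrite -entryM ee.
  by exists (entry y); rewrite -[in a * _]entry_a -[in _ * a]entry_a
    -!entryM ay ya.
rewrite (_ : (fun _ => _) =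
  entry \o fun k => (1 - e) * a%:M ^+ k * (1 - e)).
  apply: cvg_comp lim _ => A A0.
  (* The constant family [A] describes a product neighborhood of the zero matrix. *)
  by exists (fun _ _ => A) => [i j|M MA]; [rewrite mxE|exact: MA].
apply/funext => k /=.
rewrite (fitting_complement_cornerX ee ay ya) entryM entryX; congr (_ * _).
by rewrite /entry !mxE eqxx.
Qed.

End LinearTopology.

(** Reduces uniqueness of decompositions to that of idempotents. With [s] inverse to [t1], the
    partial inverse of [t] is [i1 s p1], and [(1 - e) t^k = i0 t0^k p0]. *)
Lemma fitting_decomposition_idempotent (U : category) (C : lt_category)
    (F F0 F1 : functor U C) (t : nattrans F F) (D : decomposition F F0 F1)
    (t0 : nattrans F0 F0) (t1 : nattrans F1 F1) X :
  fitting_decomposition t D t0 t1 ->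
  fitting_idempotent (t X : endo (F X)) (inj1 D X \oc prj1 D X : endo (F X)).
Proof.
move=> [tE t1iso t0lim].
have [p0i0 p1i1 p0i1 p1i0 sum1] := decomposition_biproduct D X.
have [s [st ts]] := t1iso X.
have ti1 : t X \oc inj1 D X = inj1 D X \oc t1 X.
  rewrite tE compDl -!composeA p0i1 p1i1 !comp0r add0r.
  by rewrite compose_idr.
have p1t : prj1 D X \oc t X = t1 X \oc prj1 D X.
  rewrite tE compDr !composeA p1i0 p1i1 !comp0l add0r.
  by rewrite compose_idl.
have p0t : prj0 D X \oc t X = t0 X \oc prj0 D X.
  rewrite tE compDr !composeA p0i0 p0i1 !comp0l addr0.
  by rewrite compose_idl.
split.
- rewrite -[LHS]/(_ \oc _) composeA -(composeA _ (prj1 D X)) p1i1.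
  by rewrite compose_idr.
- exists (inj1 D X \oc s \oc prj1 D X : endo (F X)).
  split; rewrite -[LHS]/(_ \oc _).
    by rewrite !composeA ti1 -(composeA _ (t1 X)) ts compose_idr.
  by rewrite -composeA p1t composeA -(composeA _ s) st compose_idr.
rewrite (_ : (fun _ => _) = fun k =>
  inj0 D X \oc ((t0 X : endo (F0 X)) ^+ k : endo (F0 X)) \oc prj0 D X).
  exact: (cvg0_comp (fun=> inj0 D X) (fun=> prj0 D X) (t0lim X)).
apply/funext => k.
have -> : 1 - (inj1 D X \oc prj1 D X : endo (F X)) = inj0 D X \oc prj0 D X.
  by apply/eqP; rewrite subr_eq; apply/eqP; rewrite sum1.
rewrite -[LHS]/(_ \oc ((t X : endo (F X)) ^+ k : endo (F X))) -!composeA.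
by rewrite (comp_intertwine_exp k p0t).
Qed.

(** * Uniqueness, then existence, of the decomposition *)

Theorem theorem7p2 (U : category) (C : lt_category)
    (C_hausdorff : hausdorff_category C)
    (C_pseudo_abelian : pseudo_abelian C)
    (C_fitting : forall X : C, fitting_property (endo X))
    (F : functor U C) (t : nattrans F F) :
  (exists (F0 F1 : functor U C) (D : decomposition F F0 F1)
     (t0 : nattrans F0 F0) (t1 : nattrans F1 F1),
     fitting_decomposition t D t0 t1)
  /\
  (forall (F0 F1 F0' F1' : functor U C)
     (D : decomposition F F0 F1) (t0 : nattrans F0 F0) (t1 : nattrans F1 F1)
     (D' : decomposition F F0' F1') (t0' : nattrans F0' F0')
     (t1' : nattrans F1' F1'),
     fitting_decomposition t D t0 t1 -> fitting_decomposition t D' t0' t1' ->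
     isomorphic_decompositions D D').
Proof.
split; last first.
  move=> F0 F1 F0' F1' D t0 t1 D' t0' t1' tD tD'.
  (* The identity of [F X] intertwines [t X] with itself, so its two Fitting idempotents agree. *)
  have ip1 X : inj1 D X \oc prj1 D X = inj1 D' X \oc prj1 D' X.
    rewrite -[LHS]compose_idl -[RHS]compose_idr.
    apply: fitting_idempotent_natural C_hausdorff
      (fitting_decomposition_idempotent X tD)
      (fitting_decomposition_idempotent X tD') _.
    by rewrite compose_idl compose_idr.
  have ip0 X : inj0 D X \oc prj0 D X = inj0 D' X \oc prj0 D' X.
    have [_ _ _ _ sD] := decomposition_biproduct D X.
    have [_ _ _ _ sD'] := decomposition_biproduct D' X.
    by apply: (addIr (inj1 D X \oc prj1 D X)); rewrite sD ip1 sD'.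
  have pi0 X := let: And5 pi _ _ _ _ := decomposition_biproduct D X in pi.
  have pi0' X := let: And5 pi _ _ _ _ := decomposition_biproduct D' X in pi.
  have pi1 X := let: And5 _ pi _ _ _ := decomposition_biproduct D X in pi.
  have pi1' X := let: And5 _ pi _ _ _ := decomposition_biproduct D' X in pi.
  have [iso0 is0 sp0] := nat_comp_retract pi0 pi0' ip0.
  have [iso1 is1 sp1] := nat_comp_retract pi1 pi1' ip1.
  by exists (nat_comp (prj0 D') (inj0 D)), (nat_comp (prj1 D') (inj1 D)).
have fitX X := cid (fitting_idempotent_ex (t X) (C_fitting (F X))).
pose e X : mor (F X) (F X) := sval (fitX X).
have te X : fitting_idempotent (t X : endo (F X)) (e X) := svalP (fitX X).
have eN X Y (u : mor X Y) : fmor F u \oc e X = e Y \oc fmor F u.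
  exact: fitting_idempotent_natural (te X) (te Y) (naturality t u).
have ee X : e X \oc e X = e X by have [] := te X.
(* Here the intertwining morphism is [t X] itself. *)
have te_comm X : t X \oc e X = e X \oc t X.
  exact: fitting_idempotent_natural (te X) (te X) erefl.
pose E := NatTrans (F := F) (G := F) eN.
pose c X := idmor (F X) - e X.
have cc X : c X \oc c X = c X.
  by rewrite compBl compose_idl compBr compose_idr ee subrr subr0.
have [F1 [i1 [p1 s1]]] :=
  split_idempotent_nattrans (E := E) C_pseudo_abelian ee.
have [F0 [i0 [p0 s0]]] :=
  split_idempotent_nattrans (E := nat_complement E) C_pseudo_abelian cc.
have ip1 X : i1 X \oc p1 X = e X := (s1 X).1.
have pi1 X : p1 X \oc i1 X = idmor (F1 X) := (s1 X).2.
have ip0 X : i0 X \oc p0 X = c X := (s0 X).1.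
have pi0 X : p0 X \oc i0 X = idmor (F0 X) := (s0 X).2.
have pe1 X : p1 X \oc e X = p1 X by rewrite -ip1 composeA pi1 compose_idl.
have ci0 X : c X \oc i0 X = i0 X by rewrite -ip0 -composeA pi0 compose_idr.
have pc0 X : p0 X \oc c X = p0 X by rewrite -ip0 composeA pi0 compose_idl.
have ei0 X : e X \oc i0 X = 0.
  by rewrite -ci0 composeA compBr compose_idr ee subrr comp0l.
have pe0 X : p0 X \oc e X = 0.
  by rewrite -pc0 -composeA compBl compose_idl ee subrr comp0r.
have ct X : c X \oc t X = t X \oc c X.
  by rewrite compBl compBr compose_idl compose_idr te_comm.
have D_biproduct X : is_biproduct (i0 X) (i1 X) (p0 X) (p1 X).
  (* The mixed composites vanish because [e X] and its complement [c X] are orthogonal. *)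
  split=> //; last by rewrite ip0 ip1 subrK.
    by rewrite -[i1 X]compose_idr -pi1 !composeA -(composeA _ (i1 X)) ip1
      pe0 comp0l.
  by rewrite -pe1 -composeA ei0 comp0r.
exists F0, F1, (Decomposition D_biproduct).
exists (nat_comp p0 (nat_comp t i0)), (nat_comp p1 (nat_comp t i1)).
split=> X /=.
(* As [t] commutes with [c] and [e], its two diagonal blocks are [t c] and [t e], with sum [t]. *)
- rewrite !composeA ip0 ip1 ct -te_comm -!composeA ip0 ip1 cc ee.
  by rewrite -compDr subrK compose_idr.
- have [_ [y [ty yt]] _] := te X.
  have {}ty : t X \oc (y : mor (F X) (F X)) = e X := ty.
  have {}yt : (y : mor (F X) (F X)) \oc t X = e X := yt.
  (* The inverse of [t1] is the compression of [y] to [F1 X]. *)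
  exists (p1 X \oc (y : mor (F X) (F X)) \oc i1 X).
  split; rewrite !composeA -(composeA _ (i1 X)) ip1.
    by rewrite -(composeA _ (e X)) -te_comm composeA -(composeA _ y) yt !pe1.
  by rewrite -(composeA _ (t X)) te_comm composeA pe1 -(composeA _ (t X)) ty
    pe1.
have [_ _ nullX] := te X.
(* Powers of [t0] are compressions of powers of [t], since [i0] intertwines the two; [p0] absorbs
   the factor [1 - e]. *)
rewrite (_ : (fun _ => _) = fun k => p0 X
    \oc ((1 - (e X : endo (F X))) * (t X : endo (F X)) ^+ k : endo (F X))
    \oc i0 X).
  exact: (cvg0_comp (fun=> p0 X) (fun=> i0 X) nullX).
apply/funext => k.
rewrite -[_ * _]/(c X \oc (_ : endo (F X))) (composeA _ (c X)) pc0 -composeA.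
have it : i0 X \oc (p0 X \oc (t X \oc i0 X)) = t X \oc i0 X.
  by rewrite !composeA ip0 ct -composeA ci0.
by rewrite -(comp_intertwine_exp k it) (composeA _ (i0 X)) pi0 compose_idl.
Qed.
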